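(* Let $X\subset\mathbb{R}^n$ be a closed and unbounded set, let $I=\{1,\ldots,m\}$, and let $f=(f_1,\ldots,f_m):\mathbb{R}^n\to\mathbb{R}^m$ be such that each $f_i:\mathbb{R}^n\to\mathbb{R}$, $i\in I$, is lower semicontinuous. Assume that $$X^{\infty}\cap\Big(\bigcup_{i\in I}\mathcal{K}(f_i)\Big)=\{0\}.$$ Then the following statements hold: (a) For each $i\in I$, the set $\mathrm{argmin}_X f_i$ is nonempty and compact. Consequently, $f$ is bounded from below on $X$, i.e., there exists $a\in\mathbb{R}^m$ such that $f(X)\subset a+\mathbb{R}^m_+$. (b) For each $\lambda\in\Lambda$, the set $S(\lambda)$ is nonempty and compact. Consequently, $\mathrm{Sol}^w$ is nonempty. (c) For all $\lambda\in\Lambda$, the function $\varphi_\lambda(\cdot):=\langle\lambda,f(\cdot)\rangle$ is coercive on $X$, i.e., $\varphi_\lambda(x)\to+\infty$ as $\|x\|\to\infty$ with $x\in X$. (d) $\mathrm{Sol}^w$ is compact. (e) The problem has a weak sharp minimum at infinity, i.e., there exist constants $c>0$ and $R>0$ such that $$\mathrm{dist}(f(x),f(\mathrm{Sol}^w))\ge c\,\mathrm{dist}(x,\mathrm{Sol}^w)\quad\text{for all }x\in X\setminus\mathbb{B}_R.$$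
   Context: All spaces are finite-dimensional Euclidean spaces with inner product $\langle\cdot,\cdot\rangle$ and norm $\|\cdot\|$; $\mathbb{B}_R$ is the open ball of radius $R$ centered at the origin; $\mathbb{R}^m_+$ is the nonnegative orthant; $\mathrm{dist}$ is the Euclidean point-to-set distance. Vector problem: minimize $f(x)$ over $x\in X$ with respect to the order given by $\mathbb{R}^m_+$. A point $\bar x\in X$ is a weak Pareto solution if $f(X)\cap(f(\bar x)-\mathrm{int}\,\mathbb{R}^m_+)=\emptyset$, i.e., there is no $x\in X$ with $f_i(x)<f_i(\bar x)$ for all $i\in I$. $\mathrm{Sol}^w$ denotes the set of all weak Pareto solutions. $\Lambda:=\{\lambda\in\mathbb{R}^m_+:\sum_{i=1}^m\lambda_i=1\}$. For $\lambda\in\Lambda$, $S(\lambda)$ is the set of minimizers of $x\mapsto\langle\lambda,f(x)\rangle$ over $X$. $\mathrm{argmin}_X f_i:=\{x\in X: f_i(x)\le f_i(y)\ \forall y\in X\}$. Asymptotic cone: $X^\infty:=\{d\in\mathbb{R}^n:\exists\, t_k\to+\infty,\ \exists\, x_k\in X,\ x_k/t_k\to d\}$. Asymptotic function of $\varphi:\mathbb{R}^n\to\mathbb{R}$: $\varphi^\infty(d):=\inf\{\liminf_{k\to\infty}\varphi(t_kd_k)/t_k:\ t_k\to+\infty,\ d_k\to d\}\in\mathbb{R}\cup\{\pm\infty\}$. $\mathcal{K}(\varphi):=\{d\in\mathbb{R}^n:\varphi^\infty(d)\le 0\}$. *)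

(* Defs.v *)
From HB Require Import structures.
From mathcomp Require Export all_boot all_order all_algebra.
From mathcomp Require Export all_classical all_reals all_analysis.
Export Order.TTheory GRing.Theory Num.Theory.
Export numFieldNormedType.Exports.

Set Implicit Arguments.
Unset Strict Implicit.
Unset Printing Implicit Defensive.

Local Open Scope classical_set_scope.
Local Open Scope ring_scope.

(* The library's norm `|x| on 'rV[R]_n is the sup norm, so the Euclidean
   structure is introduced here; both norms induce the same topology, and the
   library's open, closed, compact and convergence are used as they are. *)
Definition inner {R : realType} {n : nat} (u v : 'rV[R]_n) : R :=
  \sum_(i < n) u 0 i * v 0 i.

Definition enorm {R : realType} {n : nat} (u : 'rV[R]_n) : R :=
  Num.sqrt (inner u u).

Definition unbounded {R : realType} {n : nat} (X : set 'rV[R]_n) : Prop :=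
  forall r : R, exists2 x, X x & r < enorm x.

Definition eball0 {R : realType} {n : nat} (r : R) : set 'rV[R]_n :=
  [set x | enorm x < r].

(* Extended-valued, so that the distance to the empty set is +oo. *)
Definition edistE {R : realType} {n : nat} (x : 'rV[R]_n) (A : set 'rV[R]_n) :
    \bar R :=
  ereal_inf [set (enorm (x - a))%:E | a in A].

Definition orthant {R : realType} {m : nat} : set 'rV[R]_m :=
  [set v | forall i, 0 <= v 0 i].

Definition simplex {R : realType} {m : nat} : set 'rV[R]_m :=
  [set l | orthant l /\ \sum_(i < m) l 0 i = 1].

Definition argmin_on {R : realType} {T : Type} (X : set T) (phi : T -> R) :
    set T :=
  [set x | X x /\ forall y, X y -> phi x <= phi y].

Definition scalarized {R : realType} {n m : nat} (f : 'rV[R]_n -> 'rV[R]_m)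
    (l : 'rV[R]_m) : 'rV[R]_n -> R :=
  fun x => inner l (f x).

Definition weak_pareto {R : realType} {n m : nat} (X : set 'rV[R]_n)
    (f : 'rV[R]_n -> 'rV[R]_m) : set 'rV[R]_n :=
  [set xb | X xb /\
    (f @` X) `&` [set f xb - v | v in interior (@orthant R m)] = set0].

Definition asymptotic_cone {R : realType} {n : nat} (X : set 'rV[R]_n) :
    set 'rV[R]_n :=
  [set d | exists (t : nat -> R) (x : nat -> 'rV[R]_n),
     [/\ t k @[k --> \oo] --> +oo,
         forall k, X (x k)
       & (t k)^-1 *: x k @[k --> \oo] --> d]].

Definition asymptotic_function {R : realType} {n : nat} (phi : 'rV[R]_n -> R)
    (d : 'rV[R]_n) : \bar R :=
  ereal_inf [set l | exists (t : nat -> R) (dk : nat -> 'rV[R]_n),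
     [/\ t k @[k --> \oo] --> +oo,
         dk k @[k --> \oo] --> d
       & l = limn_einf (fun k => (phi (t k *: dk k) / t k)%:E)]].

Definition asymptotic_sublevel {R : realType} {n : nat}
    (phi : 'rV[R]_n -> R) : set 'rV[R]_n :=
  [set d | (asymptotic_function phi d <= 0)%E].

Definition coercive_on {R : realType} {n : nat} (X : set 'rV[R]_n)
    (phi : 'rV[R]_n -> R) : Prop :=
  forall M : R, exists r : R, forall x, X x -> r <= enorm x -> M <= phi x.

Definition weak_sharp_min_at_infinity {R : realType} {n m : nat}
    (X : set 'rV[R]_n) (f : 'rV[R]_n -> 'rV[R]_m) : Prop :=
  exists c r : R, [/\ 0 < c, 0 < r &
    forall x, (X `\` eball0 r) x ->
      (c%:E * edistE x (weak_pareto X f)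
         <= edistE (f x) (f @` weak_pareto X f))%E].

(* Main.v *)
Require Import Defs.
From mathcomp Require Import lra.
Local Open Scope classical_set_scope.
Local Open Scope ring_scope.
Set Implicit Arguments.
Unset Strict Implicit.
Unset Printing Implicit Defensive.

(** Everything follows from one estimate: under the asymptotic hypothesis each
    [f_i] grows at least linearly on [X], that is, [|x| <= K * f_i x] for all
    [x] in [X] of large norm ([linear_growth]). If it failed, there would be
    points [x_k] of [X] with [|x_k|] tending to infinity and
    [f_i x_k / |x_k|] eventually below every positive number; by compactness
    of the unit sphere the directions [x_k / |x_k|] accumulate at a unit vector
    [d], which lies in the asymptotic cone of [X] and satisfies
    [f_i^oo d <= 0], against the hypothesis.

    A single [K] serves all the finitely many [f_i], hence all their convex
    combinations as well. So every scalarization is coercive, its sublevel sets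
    in the closed set [X] are compact, and lower semicontinuous functions attain
    their minima there ([argmin_nonempty_compact]). A minimizer of one [f_i] is
    weakly Pareto optimal.

    A point [x] of [X] is weakly Pareto optimal iff for every [y] in [X] some
    [i] has [f_i x <= f_i y]. Lower semicontinuity makes this a closed condition,
    and a single [y] confines the solutions to a finite union of compact
    sublevel sets, which proves compactness.

    For the weak sharp minimum, [f] may be unbounded on the compact solution
    set, being only lower semicontinuous. But comparing each solution [s] with a
    fixed solution [s0] yields a coordinate [i] with [f_i s <= f_i s0], and in
    that coordinate [f x] is at least [|x| / K - f_i s0] away from [f s],
    whereas [x] is at most [|x| + |s0|] away from the solution set.

    Norm bars denote the sup norm, in which the topology of row vectors is
    defined; it is comparable with the Euclidean norm, which is enough because
    all constants above are free. *)

(** * Sup norm and Euclidean norm *)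

Lemma coord_le_norm (R : realType) (n : nat) (x : 'rV[R]_n) (i : 'I_n) :
  `|x 0 i| <= `|x|.
Proof.
rewrite [leRHS]mx_normrE.
exact: (le_bigmax _ (fun ij => `|x ij.1 ij.2|) (0, i)).
Qed.

Lemma inner_ge0 (R : realType) (n : nat) (x : 'rV[R]_n) : 0 <= inner x x.
Proof. by apply: sumr_ge0 => i _; rewrite -expr2 sqr_ge0. Qed.

Lemma norm_le_enorm (R : realType) (n : nat) (x : 'rV[R]_n) : `|x| <= enorm x.
Proof.
rewrite [leLHS]mx_normrE; apply/bigmax_leP; split=> [|[i j] _ /=].
  exact: sqrtr_ge0.
rewrite ord1 -sqrtr_sqr ler_sqrt ?inner_ge0// /inner (bigD1 j)//= expr2.
by rewrite lerDl sumr_ge0// => k _; rewrite -expr2 sqr_ge0.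
Qed.

Lemma enorm_le_norm (R : realType) (n : nat) (x : 'rV[R]_n) :
  enorm x <= n.+1%:R * `|x|.
Proof.
have h0 : 0 <= n.+1%:R * `|x| by rewrite mulr_ge0.
rewrite /enorm -[leRHS]ger0_norm// -sqrtr_sqr ler_sqrt ?sqr_ge0//.
apply: (@le_trans _ _ (\sum_(i < n) `|x| ^+ 2)).
  apply: ler_sum => i _; rewrite -expr2.
  by rewrite -[leLHS]real_normK ?num_real// lerXn2r ?nnegrE// coord_le_norm.
rewrite sumr_const card_ord -[leLHS]mulr_natl exprMn ler_wpM2r ?sqr_ge0//.
by rewrite -natrX ler_nat -mulnn (leq_trans (leqnSn n))// leq_pmulr.
Qed.

(** * Linear growth at infinity *)

Lemma cluster_subsequence (R : realType) (V : normedModType R)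
    (u : nat -> V) (d : V) :
  cluster (u @ \oo) d ->
  exists s : nat -> nat,
    (forall k, (k <= s k)%N) /\ u (s k) @[k --> \oo] --> d.
Proof.
move=> ud.
have /choice[s hs] : forall k, exists j, (k <= j)%N /\ `|d - u j| < k.+1%:R^-1.
  move=> k; have [] := ud [set u j | j in [set j | (k <= j)%N]] (ball d k.+1%:R^-1).
  - by exists k => // j kj /=; exists j.
  - by apply: nbhsx_ballx; rewrite invr_gt0.
  move=> _ [[j kj <-]]; rewrite -ball_normE /= => dj.
  by exists j.
exists s; split=> [k|]; first by have [] := hs k.
apply/cvgrPdist_lt => e e0.
have /cvgrPdist_lt/(_ e e0) := @cvg_harmonic R.
apply: filterS => k /=; rewrite sub0r normrN ger0_norm ?invr_ge0//.
by apply: lt_trans; have [] := hs k.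
Qed.

Lemma limn_einf_le0 (R : realType) (u : nat -> \bar R) :
  (forall k, u k <= (k.+1%:R^-1)%:E)%E -> (limn_einf u <= 0)%E.
Proof.
move=> uh; rewrite limn_einf_lim.
rewrite -(cvg_lim (@ereal_hausdorff R) (@cvge_harmonic R)).
apply: lee_lim; first exact: is_cvg_einfs.
  by apply/cvg_ex; exists 0%E; exact: cvge_harmonic.
near=> k; apply: (le_trans _ (uh k)).
by apply: ereal_inf_lbound; exists k => /=.
Unshelve. all: by end_near.
Qed.

(** One integer serves both as the threshold on the norm and as the growth
    constant, so that the property is monotone in it and finitely many functions
    can be treated with a common value. *)
Definition grows_linearly_on (R : realType) (n : nat) (X : set 'rV[R]_n)
    (phi : 'rV[R]_n -> R) (k : nat) : Prop :=
  forall x, X x -> k.+1%:R <= `|x| -> `|x| <= k.+1%:R * phi x.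

Lemma grows_linearly_onW (R : realType) (n : nat) (X : set 'rV[R]_n)
    (phi : 'rV[R]_n -> R) (j k : nat) :
  (j <= k)%N -> grows_linearly_on X phi j -> grows_linearly_on X phi k.
Proof.
move=> jk gj x Xx kx.
(* [phi x] is nonnegative since [|x|] is, so a larger constant is weaker. *)
have jkR : j.+1%:R <= k.+1%:R :> R by rewrite ler_nat.
have xj := gj x Xx (le_trans jkR kx).
apply: (le_trans xj); rewrite ler_wpM2r//.
by rewrite -(pmulr_rge0 _ (ltr0Sn R j)) (le_trans _ xj).
Qed.

(** Were there no such [k], a point [x_k] of [X] would violate the property for
    each [k]; a limit direction [d] of the [x_k] is a unit vector of the
    asymptotic cone, and [phi x_k / |x_k| < 1 / k.+1] forces the asymptotic
    function of [phi] to be nonpositive at [d]. *)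
Lemma linear_growth (R : realType) (n : nat) (X : set 'rV[R]_n)
    (phi : 'rV[R]_n -> R) :
  asymptotic_cone X `&` asymptotic_sublevel phi `<=` [set 0] ->
  exists k, grows_linearly_on X phi k.
Proof.
move=> X0; apply: contrapT => /forallNP noK.
have /choice[x hx] : forall k, exists x,
    [/\ X x, k.+1%:R <= `|x| & k.+1%:R * phi x < `|x| ].
  move=> k; apply: contrapT => /forallNP nox; apply: (noK k) => x Xx kx.
  by rewrite leNgt; apply/negP => h; apply: (nox x).
have x_gt0 k : 0 < `|x k| by have [_ + _] := hx k; apply: lt_le_trans.
pose u k := `|x k|^-1 *: x k.
have nu k : `|u k| = 1.
  by rewrite normrZ normfV normr_id mulVf// gt_eqF.
have sphere_compact : compact [set v : 'rV[R]_n | `|v| = 1].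
  apply: bounded_closed_compact.
    exists 1; split=> // M M1 v /= ->; exact: ltW.
  apply: (@preimage_closed _ _ (fun v : 'rV[R]_n => `|v|) [set 1]) => [v _|].
    exact: norm_continuous.
  exact: closed_eq.
have [|d [/= d1 ud]] := sphere_compact (u @ \oo) _.
  by exists 0%N => // k _; exact: nu.
have [s [ks usd]] := cluster_subsequence ud.
have ksR k : k.+1%:R <= (s k).+1%:R :> R by rewrite ler_nat ltnS.
have t_oo : `|x (s k)| @[k --> \oo] --> +oo.
  apply/cvgryPge => A; near=> k.
  have [_ + _] := hx (s k); apply: le_trans; apply: (le_trans _ (ksR k)).
  rewrite (@le_trans _ _ k%:R) ?ler_nat//.
  by near: k; exact: nbhs_infty_ger.
suff d0 : d = 0 by move: d1; rewrite d0 normr0 => /eqP; rewrite eq_sym oner_eq0.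
apply: X0; split.
  by exists (fun k => `|x (s k)|), (x \o s); split=> // k; have [] := hx (s k).
apply: (@le_trans _ _ (limn_einf
    (fun k => (phi (`|x (s k)| *: u (s k)) / `|x (s k)|)%:E))).
  by apply: ereal_inf_lbound; exists (fun k => `|x (s k)|), (u \o s).
apply: limn_einf_le0 => k; rewrite lee_fin scalerA divff ?gt_eqF// scale1r.
rewrite ler_pdivrMr// (@le_trans _ _ ((s k).+1%:R^-1 * `|x (s k)|))//.
  by have [_ _ /ltW] := hx (s k); rewrite ler_pdivlMl.
by rewrite ler_wpM2r// lef_pV2 ?posrE.
Unshelve. all: by end_near.
Qed.

Lemma grows_linearly_coercive (R : realType) (n : nat) (X : set 'rV[R]_n)
    (phi : 'rV[R]_n -> R) (k : nat) :
  grows_linearly_on X phi k -> coercive_on X phi.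
Proof.
move=> gk M; exists (n.+1%:R * Num.max k.+1%:R (k.+1%:R * M)) => x Xx.
move=> /le_trans /(_ (enorm_le_norm x)).
rewrite ler_pM2l// ge_max => /andP[kx Mx].
by have := le_trans Mx (gk x Xx kx); rewrite ler_pM2l.
Qed.

(** * Existence of minimizers *)

Lemma closed_sublevel (R : realType) (T : topologicalType) (phi : T -> R)
    (a : R) :
  lower_semicontinuous (fun x => (phi x)%:E) -> closed [set x | phi x <= a].
Proof.
move=> /lower_semicontinuousP /(_ a) /open_closedC; congr closed.
by apply/seteqP; split=> x /=; rewrite lte_fin leNgt => /negP.
Qed.

Lemma compact_sublevel (R : realType) (n : nat) (X : set 'rV[R]_n)
    (phi : 'rV[R]_n -> R) (a : R) :
  closed X -> lower_semicontinuous (fun x => (phi x)%:E) ->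
  coercive_on X phi -> compact (X `&` [set x | phi x <= a]).
Proof.
move=> Xcl lsc /(_ (a + 1))[r hr]; apply: bounded_closed_compact; last first.
  by apply: closedI => //; exact: closed_sublevel.
exists r; split=> [|M rM x [Xx /= xa]]; first exact: num_real.
rewrite (le_trans (norm_le_enorm x))// (le_trans _ (ltW rM))// leNgt.
apply/negP => /ltW /(hr x Xx); lra.
Qed.

(** Weierstrass' theorem for lower semicontinuous functions: the nonempty
    sublevel sets in [K] form a chain, hence a filter base, and a cluster point
    belongs to all of them because they are closed relative to [K]. *)
Lemma lsc_compact_argmin (R : realType) (T : topologicalType) (K : set T)
    (phi : T -> R) :
  compact K -> K !=set0 -> lower_semicontinuous (fun x => (phi x)%:E) ->
  argmin_on K phi !=set0.
Proof.
move=> Kco K0 lsc; pose sub y := K `&` [set x | phi x <= phi y].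
have Ff : Filter (filter_from K sub).
  apply: filter_from_filter => // x y Kx Ky.
  have [xy|/ltW yx] := leP (phi x) (phi y); [exists x | exists y] => // z [Kz zx].
    by split; split=> //=; exact: le_trans xy.
  by split; split=> //=; exact: le_trans yx.
have Fp : ProperFilter (filter_from K sub).
  by apply: filter_from_proper => x Kx; exists x; split=> /=.
have [|x [Kx]] := Kco (filter_from K sub) Fp.
  by have [y Ky] := K0; exists y => // z [].
rewrite clusterE => clx; exists x; split=> // y Ky.
have /closure_id clE := closed_sublevel (a := phi y) lsc.
suff : [set z | phi z <= phi y] x by [].
by rewrite clE; apply: clx; exists y => // z [].
Qed.

(** The set of minimizers is itself a compact sublevel set, at the minimal
    value. *)
Lemma argmin_nonempty_compact (R : realType) (n : nat) (X : set 'rV[R]_n)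
    (phi : 'rV[R]_n -> R) :
  closed X -> X !=set0 -> lower_semicontinuous (fun x => (phi x)%:E) ->
  coercive_on X phi -> argmin_on X phi !=set0 /\ compact (argmin_on X phi).
Proof.
move=> Xcl [x0 Xx0] lsc co.
have [|x [[Xx xx0] xmin]] :=
    lsc_compact_argmin (compact_sublevel (a := phi x0) Xcl lsc co) _ lsc.
  by exists x0; split=> /=.
have xminX y : X y -> phi x <= phi y.
  move=> Xy; have [yx0|/ltW x0y] := leP (phi y) (phi x0); first exact: xmin.
  exact: le_trans xx0 x0y.
split; first by exists x.
have -> : argmin_on X phi = X `&` [set y | phi y <= phi x].
  apply/seteqP; split=> y [Xy h]; split=> //=; first exact: h.
  by move=> z Xz; apply: (le_trans h); exact: xminX.
exact: compact_sublevel.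
Qed.

(** * Scalarizations *)

(** The weights sum to one, so lowering every coordinate by [e / 2] lowers the
    scalarization by exactly [e / 2]. *)
Lemma lsc_scalarized (R : realType) (n m : nat) (f : 'rV[R]_n -> 'rV[R]_m)
    (l : 'rV[R]_m) :
  (forall i, lower_semicontinuous (fun x => (f x 0 i)%:E)) ->
  simplex l -> lower_semicontinuous (fun x => (scalarized f l x)%:E).
Proof.
move=> flsc [l0 l1] x a; rewrite lte_fin => ax.
pose e := scalarized f l x - a.
have e0 : 0 < e by rewrite subr_gt0.
exists [set y | forall i, f x 0 i - e / 2 < f y 0 i].
  suff : \forall y \near x, forall i, f x 0 i - e / 2 < f y 0 i by [].
  apply: (@filter_forall _ _ (fun i y => f x 0 i - e / 2 < f y 0 i) (nbhs x)) => i.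
  have [|V Vx Vf] := flsc i x (f x 0 i - e / 2).
    by rewrite lte_fin gtrBl divr_gt0.
  by apply: filterS Vx => y /Vf; rewrite lte_fin.
move=> y xy; rewrite lte_fin.
have : scalarized f l x - e / 2 <= scalarized f l y.
  rewrite -[e / 2]mul1r -[X in X * (e / 2)]l1 mulr_suml /scalarized /inner -sumrB.
  by apply: ler_sum => i _; rewrite -mulrBr ler_wpM2l ?l0// ltW.
apply: lt_le_trans; rewrite /e; lra.
Qed.

Lemma grows_linearly_scalarized (R : realType) (n m : nat) (X : set 'rV[R]_n)
    (f : 'rV[R]_n -> 'rV[R]_m) (l : 'rV[R]_m) (k : nat) :
  (forall i, grows_linearly_on X (fun x => f x 0 i) k) ->
  simplex l -> grows_linearly_on X (scalarized f l) k.
Proof.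
move=> gf [l0 l1] x Xx kx; rewrite -[leLHS]mul1r -[X in X * _ <= _]l1 mulr_suml mulr_sumr.
by apply: ler_sum => i _; rewrite mulrCA ler_wpM2l ?l0//; exact: gf.
Qed.

(** * Weak Pareto solutions *)

Lemma interior_orthant (R : realType) (m : nat) :
  interior (@orthant R m) = [set v | forall i, 0 < v 0 i].
Proof.
apply/seteqP; split=> v /= hv.
  move=> i; have /nbhs_ballP[e /= e0 ve] := hv.
  (* Moving all coordinates down by [e / 2] stays in the ball of radius [e]. *)
  have : orthant (v - const_mx (e / 2)).
    apply: ve; rewrite -ball_normE /= opprB addrC subrK [ltLHS]mx_normrE.
    apply: le_lt_trans (_ : e / 2 < e); last by rewrite ltr_pdivrMr// ltr_pMr// ltr1n.
    apply/bigmax_leP; split=> [|[j k] _]; first by rewrite ltW// divr_gt0.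
    by rewrite mxE ger0_norm// ltW// divr_gt0.
  move=> /(_ i); rewrite !mxE subr_ge0; apply: lt_le_trans; exact: divr_gt0.
suff : \forall w \near v, forall i : 'I_m, 0 < (w : 'rV[R]_m) 0 i.
  by apply: filterS => w hw i; exact: ltW.
apply: (@filter_forall _ _ (fun i w => 0 < (w : 'rV[R]_m) 0 i) (nbhs v)) => i.
have := @coord_continuous R 1 m 0 i v.
by move=> /cvgr_gt; apply; exact: hv.
Qed.

Lemma weak_paretoP (R : realType) (n m : nat) (X : set 'rV[R]_n)
    (f : 'rV[R]_n -> 'rV[R]_m) (x : 'rV[R]_n) :
  weak_pareto X f x <->
  X x /\ forall y, X y -> exists i, f x 0 i <= f y 0 i.
Proof.
rewrite /weak_pareto interior_orthant; split=> -[Xx h]; split=> //.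
  move=> y Xy; apply: contrapT => /forallNP noi.
  suff : set0 (f y) by [].
  rewrite -h; split; first by exists y.
  exists (f x - f y); last by rewrite opprB addrC subrK.
  by move=> i /=; rewrite !mxE subr_gt0 ltNge; apply/negP; exact: noi.
apply/seteqP; split=> // _ [[y Xy <-] [v /= v0 yv]].
have [i] := h y Xy; rewrite -yv !mxE; have := v0 i; lra.
Qed.

(** In this form the solution set is visibly closed when the [f_i] are lower
    semicontinuous. *)
Lemma weak_paretoE (R : realType) (n m : nat) (X : set 'rV[R]_n)
    (f : 'rV[R]_n -> 'rV[R]_m) :
  weak_pareto X f =
  X `&` \bigcap_(y in X) \bigcup_(i in [set: 'I_m]) [set x | f x 0 i <= f y 0 i].
Proof.
apply/seteqP; split=> x.
  move=> /weak_paretoP[Xx h]; split=> // y Xy.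
  by have [i hi] := h y Xy; exists i.
move=> [Xx h]; apply/weak_paretoP; split=> // y Xy.
by have [i _ hi] := h y Xy; exists i.
Qed.

Lemma argmin_weak_pareto (R : realType) (n m : nat) (X : set 'rV[R]_n)
    (f : 'rV[R]_n -> 'rV[R]_m) (i : 'I_m) :
  argmin_on X (fun x => f x 0 i) `<=` weak_pareto X f.
Proof.
move=> x [Xx xmin]; apply/weak_paretoP; split=> // y Xy.
by exists i; exact: xmin.
Qed.

(** Comparison with a single [y] of [X] already places every solution in one of
    the compact sets where some [f_i] is at most [f_i y]. *)
Lemma compact_weak_pareto (R : realType) (n m : nat) (X : set 'rV[R]_n)
    (f : 'rV[R]_n -> 'rV[R]_m) :
  closed X -> X !=set0 ->
  (forall i, lower_semicontinuous (fun x => (f x 0 i)%:E)) ->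
  (forall i, coercive_on X (fun x => f x 0 i)) ->
  compact (weak_pareto X f).
Proof.
move=> Xcl [y Xy] flsc fco.
apply: (@subclosed_compact _ _
    (\big[setU/set0]_(i < m) (X `&` [set x | f x 0 i <= f y 0 i]))).
- rewrite weak_paretoE; apply: closedI => //; apply: closed_bigI => z _.
  by apply: closed_bigcup => [|i _]; [exact: finite_finset|exact: closed_sublevel].
- by apply: bigsetU_compact => i _; exact: compact_sublevel.
- move=> x /weak_paretoP[Xx h]; have [i xi] := h y Xy.
  by rewrite -bigcup_seq; exists i => //=; rewrite mem_index_enum.
Qed.

(** A solution [s] satisfies [f_i s <= f_i s0] for some [i] depending on [s], and
    this one coordinate bounds the distance from [f x] to [f s] from below
    uniformly in [s], even if [f] is unbounded on the solution set. *)
Lemma weak_sharp_of_linear_growth (R : realType) (n m : nat) (X : set 'rV[R]_n)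
    (f : 'rV[R]_n -> 'rV[R]_m) (k : nat) :
  weak_pareto X f !=set0 ->
  (forall i, grows_linearly_on X (fun x => f x 0 i) k) ->
  weak_sharp_min_at_infinity X f.
Proof.
move=> [s0 Ss0] gf.
have [Xs0 _] := (weak_paretoP X f s0).1 Ss0.
(* [k.+1] makes the growth estimate available; the other two terms let half of
   the slope [1 / k.+1] absorb the offsets [|s0|] and [|f s0|]. The factors
   [n.+1] convert between the Euclidean and the sup norm. *)
pose rho : R := k.+1%:R + `|s0| + 2 * k.+1%:R * `|f s0|.
exists (2 * k.+1%:R * n.+1%:R)^-1, (n.+1%:R * rho); split.
- by rewrite invr_gt0 !mulr_gt0.
- by rewrite mulr_gt0// /rho -addrA ltr_wpDr// addr_ge0// !mulr_ge0.
move=> x [Xx] /negP; rewrite -leNgt => /le_trans /(_ (enorm_le_norm x)).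
rewrite ler_pM2l// => rx.
have s0_ge0 : 0 <= `|s0| by [].
have fs0_ge0 : 0 <= 2 * k.+1%:R * `|f s0| by rewrite !mulr_ge0.
have kx : k.+1%:R <= `|x| by apply: le_trans rx; rewrite /rho; lra.
apply: (@le_trans _ _ ((2 * k.+1%:R)^-1 * (`|x| + `|s0|))%:E).
  rewrite invfM EFinM -muleA [leRHS]EFinM lee_wpmul2l//.
  apply: le_trans (_ : _ <= (n.+1%:R^-1 * enorm (x - s0))%:E)%E _.
    rewrite EFinM lee_wpmul2l// ?lee_fin ?invr_ge0//.
    by apply: ereal_inf_lbound; exists s0.
  rewrite lee_fin ler_pdivrMl// (le_trans (enorm_le_norm _))// ler_wpM2l//.
  by rewrite ler_normB.
apply: le_ereal_inf_tmp => _ [_ [s /weak_paretoP[Xs sP] <-] <-].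
rewrite lee_fin (le_trans _ (norm_le_enorm _))//.
have [i si] := sP s0 Xs0.
apply: (@le_trans _ _ (f x 0 i - f s 0 i)); last first.
  by have := coord_le_norm (f x - f s) i; rewrite !mxE; apply/le_trans/ler_norm.
have fs : f s 0 i <= `|f s0|.
  by apply: (le_trans si); apply: (le_trans (ler_norm _)); exact: coord_le_norm.
rewrite ler_pdivrMl ?mulr_gt0//.
have := gf i x Xx kx.
have : 2 * k.+1%:R * f s 0 i <= 2 * k.+1%:R * `|f s0|.
  by rewrite ler_wpM2l// mulr_ge0.
have := ltr0Sn R k; move: rx; rewrite /rho mulrBr; lra.
Qed.

(** * The theorem *)

Theorem theorem3p1 (R : realType) (n m : nat) (X : set 'rV[R]_n)
    (f : 'rV[R]_n -> 'rV[R]_m)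
    (Xclosed : closed X)
    (Xunbounded : unbounded X)
    (flsc : forall i : 'I_m,
      lower_semicontinuous (fun x : 'rV[R]_n => (f x 0 i)%:E))
    (Hasymp : asymptotic_cone X `&`
        (\bigcup_(i in [set: 'I_m]) asymptotic_sublevel (fun x => f x 0 i))
      = [set 0]) :
  (* (a) *)
  ((forall i : 'I_m, argmin_on X (fun x => f x 0 i) !=set0 /\
                     compact (argmin_on X (fun x => f x 0 i))) /\
   (exists a : 'rV[R]_m, f @` X `<=` [set a + v | v in orthant])) /\
  (* (b) *)
  ((forall l : 'rV[R]_m, simplex l ->
      argmin_on X (scalarized f l) !=set0 /\
      compact (argmin_on X (scalarized f l))) /\
   weak_pareto X f !=set0) /\
  (* (c) *)
  (forall l : 'rV[R]_m, simplex l -> coercive_on X (scalarized f l)) /\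
  (* (d) *)
  compact (weak_pareto X f) /\
  (* (e) *)
  weak_sharp_min_at_infinity X f.
Proof.
have X0 : X !=set0 by have [x Xx _] := Xunbounded 0; exists x.
(* The hypothesis puts [0] in the union over [i], so there is at least one
   objective. *)
have [i0 _] : exists i0 : 'I_m, True.
  have [_ [i _ _]] : (asymptotic_cone X `&` (\bigcup_(i in [set: 'I_m])
      asymptotic_sublevel (fun x => f x 0 i))) 0 by rewrite Hasymp.
  by exists i.
have /choice[k gk] : forall i, exists k, grows_linearly_on X (fun x => f x 0 i) k.
  move=> i; apply: linear_growth; rewrite -Hasymp => d [Xd fd].
  by split=> //; exists i.
have gf i : grows_linearly_on X (fun x => f x 0 i) (\max_j k j).
  by apply: grows_linearly_onW (gk i); exact: leq_bigmax.
have fco i : coercive_on X (fun x => f x 0 i).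
  exact: grows_linearly_coercive (gf i).
have lco l : simplex l -> coercive_on X (scalarized f l).
  by move=> /(grows_linearly_scalarized gf); exact: grows_linearly_coercive.
have fmin i : argmin_on X (fun x => f x 0 i) !=set0 /\
              compact (argmin_on X (fun x => f x 0 i)).
  exact: argmin_nonempty_compact.
have S0 : weak_pareto X f !=set0.
  by have [[x xmin] _] := fmin i0; exists x; exact: argmin_weak_pareto xmin.
split; [split=> //|split; [split=> //|split; [by []|split]]].
- have /choice[xm xmP] : forall i, exists x, argmin_on X (fun x => f x 0 i) x.
    by move=> i; have [] := fmin i.
  exists (\row_i f (xm i) 0 i) => _ [x Xx <-].
  exists (f x - \row_i f (xm i) 0 i); last by rewrite addrC subrK.
  by move=> i; rewrite !mxE subr_ge0; have [_] := xmP i; apply.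
- move=> l ls; apply: argmin_nonempty_compact => //; last exact: lco.
  exact: lsc_scalarized.
- exact: compact_weak_pareto.
- exact: weak_sharp_of_linear_growth gf.
Qed.
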